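(* Let $\alpha>1$ and $1<\beta<\alpha$, let $X$ be a complex Banach space, and suppose $T\in B(X)$ is both $\alpha$-Ritt and $\beta$-Kreiss bounded. Then for any $k\in\mathbb{N}$ such that $k<\alpha-1$, $$\|T^n(I-T)^k\| = O\Big(n^{\beta\frac{\alpha-k-1}{\alpha}}\Big).$$
   Context: $\mathbb{N}=\{1,2,\dots\}$; $B(X)$ is the algebra of bounded linear operators on $X$; $\mathbb{D}$ is the open unit disk; $R(\lambda,T)=(\lambda I-T)^{-1}$. $T$ is $\alpha$-Ritt if $\sigma(T)\subset\overline{\mathbb{D}}$ and there is $C>0$ with $\|R(\lambda,T)\|\le\frac{C}{|\lambda-1|^{\alpha}}$ for all $1<|\lambda|<2$. $T$ is $\beta$-Kreiss bounded if $\sigma(T)\subset\overline{\mathbb{D}}$ and there is $C>0$ with $\|R(\lambda,T)\|\le\frac{C}{(|\lambda|-1)^{\beta}}$ for all $1<|\lambda|<2$. For nonnegative sequences, $a_n=O(b_n)$ means there is $C>0$ with $a_n\le C b_n$ for all $n\ge1$. *)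

(* Defs.v *)
From Stdlib Require Import Reals Lra ClassicalEpsilon.
From Coquelicot Require Export Coquelicot.

Open Scope R_scope.

(* Bounded operators are maps [T : X -> X] with [is_linear T]: Coquelicot's
   [is_linear] includes the bound [norm (T x) <= M * norm x]. Completeness of [X]
   plays no role in the definitions below. *)

Section Operators.

Context {X : NormedModule C_AbsRing}.

(* The supremum is finite when [is_linear T] (see [opnorm_is_lub]); otherwise
   the projection [real] may return the default value 0. *)
Definition opnorm (T : X -> X) : R :=
  real (Lub_Rbar (fun r => exists x : X, norm x <= 1 /\ r = norm (T x))).

Definition opcomp (S T : X -> X) : X -> X := fun x => S (T x).

Definition oppow (T : X -> X) (n : nat) : X -> X := Nat.iter n (opcomp T) (fun x => x).

Definition scalar_minus (lambda : C) (T : X -> X) : X -> X :=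
  fun x => minus (scal lambda x) (T x).

Definition is_inverse (A S : X -> X) : Prop :=
  is_linear S /\ (forall x, S (A x) = x) /\ (forall x, A (S x) = x).

Definition spectrum (T : X -> X) (lambda : C) : Prop :=
  ~ exists S, is_inverse (scalar_minus lambda T) S.

(* Unspecified when [lambda] is in the spectrum. *)
Definition resolvent (lambda : C) (T : X -> X) : X -> X :=
  epsilon (inhabits (fun x => x)) (is_inverse (scalar_minus lambda T)).

Definition spectrum_in_closed_disk (T : X -> X) : Prop :=
  forall lambda : C, spectrum T lambda -> Cmod lambda <= 1.

Definition Ritt (alpha : R) (T : X -> X) : Prop :=
  spectrum_in_closed_disk T /\
  exists K : R, 0 < K /\
    forall lambda : C, 1 < Cmod lambda < 2 ->
      opnorm (resolvent lambda T) <= K / Rpower (Cmod (lambda - 1)%C) alpha.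

Definition Kreiss_bounded (beta : R) (T : X -> X) : Prop :=
  spectrum_in_closed_disk T /\
  exists K : R, 0 < K /\
    forall lambda : C, 1 < Cmod lambda < 2 ->
      opnorm (resolvent lambda T) <= K / Rpower (Cmod lambda - 1) beta.

Lemma resolventP (lambda : C) (T : X -> X) :
  ~ spectrum T lambda -> is_inverse (scalar_minus lambda T) (resolvent lambda T).
Proof.
intros H. unfold resolvent.
apply (epsilon_spec (inhabits (fun x : X => x)) (is_inverse (scalar_minus lambda T))).
now apply NNPP.
Qed.

Lemma opnorm_is_lub (T : X -> X) :
  is_linear T ->
  is_lub (fun r => exists x : X, norm x <= 1 /\ r = norm (T x)) (opnorm T).
Proof.
intros [_ _ [M [M0 HM]]].
unfold opnorm.
set (E := fun r => exists x : X, norm x <= 1 /\ r = norm (T x)).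
destruct (Lub_Rbar_correct E) as [ub lub].
assert (E0 : E (norm (T zero))).
{ exists zero. split; [| reflexivity].
  rewrite norm_zero; lra. }
assert (HMub : is_ub_Rbar E M).
{ intros r [x [Hx ->]]. simpl. pose proof (HM x). nra. }
assert (h1 := ub _ E0). assert (h2 := lub _ HMub).
destruct (Lub_Rbar E) as [l | | ]; simpl in *; try easy.
split.
- intros r Hr. exact (ub r Hr).
- intros b Hb. apply (lub b). intros r Hr. exact (Hb r Hr).
Qed.

End Operators.

Definition is_bigO (a b : nat -> R) : Prop :=
  exists K : R, 0 < K /\ forall n : nat, (1 <= n)%nat -> a n <= K * b n.

(* Main.v *)
(* With [r = 1 + 1/(2n)] and [d = n^(-beta/alpha)], Cauchy's formula on [|l| = r] gives
   [|T^n (I-T)^k| <= C * int |l-1|^k min (|l-1|^-alpha, d^-alpha) |dl|], which is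
   [O(d^(k+1-alpha))] because [alpha - k > 1].

   The integral is replaced by the mean over the [N] points [l_j = r e^(2 i pi j/N)]:
   since [sum_j l_j^a = 0] for [0 < a < N], the operators
   [S_(a,b) = (1/N) sum_j l_j^(a+1) (1-l_j)^b R(l_j,T)] satisfy, for [a + b < N], exactly
   [S_(a,b) = T^a (I-T)^b S_(0,0)], while [r^N S_(0,0) = r^N + T^N S_(0,0)]. As the spectral
   radius of [T] is at most 1, [S_(0,0)] tends to [I] when [N] grows. The same operators
   yield the bound on the spectral radius, by Rickart's argument. *)
Require Import Defs.
From Stdlib Require Import Reals Lra Lia Classical.
From Coquelicot Require Import Coquelicot.
Open Scope R_scope.

(** * Equidistributed points on a circle *)

(* The equation may be stated at a structure projection that only converts to [C]. *)
Ltac cring := match goal with |- @eq _ ?u ?v => change (@eq C u v) end; ring.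

Definition polar (r t : R) : C := (r * cos t, r * sin t).

Definition node (r : R) (N j : nat) : C := polar r (2 * PI * INR j / INR N).

Lemma cos2_sin2 (t : R) : cos t * cos t + sin t * sin t = 1.
Proof. pose proof (sin2_cos2 t) as H. unfold Rsqr in H. lra. Qed.

Lemma Cmod_polar (r t : R) : 0 <= r -> Cmod (polar r t) = r.
Proof.
intros Hr. unfold Cmod, polar; cbn [fst snd].
replace (_ + _) with (r * r)
  by (rewrite <- (Rmult_1_r (r * r)), <- (cos2_sin2 t); ring).
now apply sqrt_square.
Qed.

Lemma Cmod_polar_minus_radius (r s t : R) :
  Cmod (polar r t - polar s t)%C = Rabs (r - s).
Proof.
unfold Cmod, polar; cbn [fst snd Cminus Cplus Copp].
replace (_ + _) with (Rsqr (r - s))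
  by (unfold Rsqr; rewrite <- (Rmult_1_r ((r - s) * (r - s))), <- (cos2_sin2 t); ring).
apply sqrt_Rsqr_abs.
Qed.

Lemma Rabs_sin_le (x : R) : Rabs (sin x) <= Rabs x.
Proof.
assert (Hpos : forall y, 0 < y -> Rabs (sin y) <= y).
{ intros y Hy. apply Rabs_le. split; [|left; now apply sin_lt_x].
  destruct (Rle_dec y 1) as [H|H].
  - assert (0 < sin y); [|lra]. apply sin_gt_0; [lra|]. pose proof PI2_3_2. lra.
  - pose proof (SIN_bound y). lra. }
destruct (Rtotal_order x 0) as [H|[->|H]].
- rewrite <- (Rabs_Ropp x), (Rabs_pos_eq (- x)) by lra.
  rewrite <- Rabs_Ropp, <- sin_neg. apply Hpos; lra.
- rewrite sin_0. lra.
- rewrite (Rabs_pos_eq x) by lra. now apply Hpos.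
Qed.

(** The chord has length [2 r |sin ((s - t) / 2)|], and [|sin y| <= |y|]. *)
Lemma Cmod_polar_minus_angle (r s t : R) : 0 <= r ->
  Cmod (polar r s - polar r t)%C <= r * Rabs (s - t).
Proof.
intros Hr. rewrite <- (Rabs_pos_eq r Hr) at 3. rewrite <- Rabs_mult, <- sqrt_Rsqr_abs.
unfold Cmod, polar; cbn [fst snd Cminus Cplus Copp]. apply sqrt_le_1_alt.
set (d := (s - t) / 2).
replace (s - t) with (2 * d) by (unfold d; field).
assert (E : (r * cos s + - (r * cos t)) ^ 2 + (r * sin s + - (r * sin t)) ^ 2
  = r ^ 2 * (4 * (sin d * sin d))).
{ transitivity (r ^ 2 * ((cos s * cos s + sin s * sin s) + (cos t * cos t + sin t * sin t)
    - 2 * (cos s * cos t + sin s * sin t))); [ring|].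
  rewrite !cos2_sin2, <- cos_minus.
  replace (s - t) with (2 * d) by (unfold d; field). rewrite cos_2a_sin. ring. }
rewrite E. unfold Rsqr.
assert (H : Rsqr (sin d) <= Rsqr d) by (apply Rsqr_le_abs_1, Rabs_sin_le).
unfold Rsqr in H. pose proof (pow2_ge_0 r). nra.
Qed.

Lemma node_pow (r : R) (N j a : nat) :
  Cpow (node r N j) a = node (r ^ a) N (a * j).
Proof.
induction a as [|a IH].
- unfold node, polar; simpl. rewrite Rmult_0_r, Rdiv_0_l, cos_0, sin_0.
  apply injective_projections; simpl; ring.
- rewrite Cpow_S, IH. unfold node, polar.
  rewrite (mult_INR (S a)), S_INR, (mult_INR a).
  replace (2 * PI * ((INR a + 1) * INR j) / INR N)
    with (2 * PI * INR j / INR N + 2 * PI * (INR a * INR j) / INR N)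
    by (unfold Rdiv; ring).
  rewrite cos_plus, sin_plus.
  apply injective_projections; simpl; ring.
Qed.

(** Exchanges exponent and index: a sum over [j] of [a]-th powers of nodes becomes a geometric sum
    of ratio [node 1 N a]. *)
Lemma node_swap (r : R) (N a j : nat) :
  node r N (a * j) = (RtoC r * Cpow (node 1 N a) j)%C.
Proof.
rewrite node_pow, pow1, Nat.mul_comm. unfold node, polar.
apply injective_projections; simpl; ring.
Qed.

Lemma node_full_turn (r : R) (N j : nat) : (0 < N)%nat -> node r N (N * j) = RtoC r.
Proof.
intros HN. apply lt_0_INR in HN.
unfold node, polar. rewrite mult_INR.
replace (2 * PI * (INR N * INR j) / INR N) with (0 + 2 * INR j * PI) by (field; lra).
rewrite cos_period, sin_period, cos_0, sin_0.
apply injective_projections; simpl; ring.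
Qed.

(** With [t] half the angle, [|r e^(2it) - 1|^2 = (r - 1)^2 + 4 r sin^2 t], which is at least
    [4 sin^2 t] for [r >= 1]. *)
Lemma Cmod_node_minus_one (r : R) (N j : nat) : (0 < N)%nat -> 1 <= r ->
  2 * Rabs (sin (PI * INR j / INR N)) <= Cmod (node r N j - 1)%C.
Proof.
intros HN Hr. apply lt_0_INR in HN.
set (t := PI * INR j / INR N).
assert (Ht : 2 * PI * INR j / INR N = 2 * t) by (unfold t; field; lra).
unfold Cmod, node, polar; cbn [fst snd Cminus Cplus Copp RtoC].
rewrite Ht, cos_2a_sin, sin_2a.
rewrite <- (Rabs_pos_eq 2) at 1 by lra.
rewrite <- Rabs_mult, <- sqrt_Rsqr_abs. apply sqrt_le_1_alt.
unfold Rsqr. pose proof (cos2_sin2 t) as Hcs.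
assert (E : (r * (1 - 2 * sin t * sin t) + - (1)) ^ 2 + (r * (2 * sin t * cos t) + - 0) ^ 2
  = (r - 1) ^ 2 + 4 * r * (sin t * sin t)
    + 4 * r ^ 2 * (sin t * sin t) * (cos t * cos t + sin t * sin t - 1)) by ring.
rewrite E, Hcs.
assert (0 <= (r - 1) * (sin t * sin t)) by (apply Rmult_le_pos; [lra | apply Rle_0_sqr]).
pose proof (pow2_ge_0 (r - 1)). nra.
Qed.

(** The Taylor polynomial of degree 7 is a lower bound of the sine. As [x^2 <= 4], its first two
    terms give at least [x / 3] and the other two have a nonnegative sum. *)
Lemma sin_lower (x : R) : 0 <= x <= PI / 2 -> x / 3 <= sin x.
Proof.
intros [H0 H1]. pose proof PI_4 as H4.
destruct (SIN x H0) as [H _]; [lra|].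
refine (Rle_trans _ _ _ _ H).
unfold sin_lb, sin_approx, sin_term; simpl.
assert (x * x <= 4) by nra.
assert (0 <= x * (x * x) * (1 / 120 - x * x / 5040)).
{ apply Rmult_le_pos; [apply Rmult_le_pos; nra|lra]. }
assert (0 <= (4 - x * x) * x) by nra.
nra.
Qed.

(* Distance of [j / N] to the nearest integer; meaningful only for [j <= N]. *)
Definition arc (N j : nat) : R := Rmin (INR j / INR N) (INR (N - j) / INR N).

(** The distance is at least [2 |sin (PI t)|] with [t = j / N]. The symmetry [t -> 1 - t] reduces to
    [t <= 1/2], where [sin_lower] applies and [PI > 3] absorbs its constant. *)
Lemma arc_le_Cmod (r : R) (N j : nat) : (0 < N)%nat -> (j <= N)%nat -> 1 <= r ->
  arc N j <= Cmod (node r N j - 1)%C.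
Proof.
intros HN Hj Hr.
refine (Rle_trans _ _ _ _ (Cmod_node_minus_one r N j HN Hr)).
unfold arc. rewrite (minus_INR _ _ Hj).
apply le_INR in Hj. apply lt_0_INR in HN.
set (t := INR j / INR N).
replace (PI * INR j / INR N) with (PI * t) by (unfold t; field; lra).
replace ((INR N - INR j) / INR N) with (1 - t) by (unfold t; field; lra).
assert (Ht : 0 <= t <= 1).
{ unfold t; split.
  - apply Rdiv_le_0_compat; [apply pos_INR|lra].
  - apply Rmult_le_reg_r with (INR N); [lra|]. field_simplify; lra. }
pose proof PI2_3_2 as HP.
pose proof (Rle_abs (sin (PI * t))) as HA.
destruct (Rle_dec t (/ 2)) as [H|H].
- pose proof (Rmin_l t (1 - t)).
  assert (PI * t / 3 <= sin (PI * t)) by (apply sin_lower; nra). nra.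
- pose proof (Rmin_r t (1 - t)).
  assert (E : sin (PI * t) = sin (PI * (1 - t))).
  { rewrite <- sin_PI_x. f_equal; ring. }
  assert (PI * (1 - t) / 3 <= sin (PI * (1 - t))) by (apply sin_lower; nra).
  rewrite E in *. nra.
Qed.

Lemma node_one_neq_one (N a : nat) : (0 < a < N)%nat -> node 1 N a <> RtoC 1.
Proof.
intros [Ha HN] E.
assert (H := arc_le_Cmod 1 N a ltac:(lia) ltac:(lia) (Rle_refl 1)).
rewrite E in H. unfold Cminus in H. rewrite Cplus_opp_r, Cmod_0 in H.
assert (HNN : 0 < INR N) by (apply lt_0_INR; lia).
assert (0 < arc N a).
{ unfold arc. apply Rmin_case; apply Rdiv_lt_0_compat; try assumption;
    apply lt_0_INR; lia. }
lra.
Qed.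

Lemma geometric_sum (q : C) (m : nat) :
  ((1 - q) * sum_n (fun j => Cpow q j) m = 1 - Cpow q (S m))%C.
Proof.
induction m as [|m IH].
- rewrite sum_O. change (Cpow q 0) with (RtoC 1).
  change (Cpow q 1) with (q * 1)%C. ring.
- rewrite sum_Sn. change plus with Cplus.
  rewrite Cmult_plus_distr_l, IH, !Cpow_S. ring.
Qed.

(** Up to the factor [r^a] this is a geometric sum whose ratio [q] satisfies [q <> 1] and
    [q^(S m) = 1]. *)
Lemma node_power_sum (r : R) (m a : nat) : (0 < a < S m)%nat ->
  sum_n (fun j => Cpow (node r (S m) j) a) m = RtoC 0.
Proof.
intros Ha.
rewrite (sum_n_ext _ (fun j => scal (RtoC (r ^ a)) (Cpow (node 1 (S m) a) j))).
2: { intros j. rewrite node_pow, node_swap. reflexivity. }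
rewrite (sum_n_scal_l (K := C_Ring)).
assert (Hne : (1 - node 1 (S m) a)%C <> RtoC 0).
{ intros E. apply (node_one_neq_one (S m) a Ha).
  replace (node 1 (S m) a) with (1 - (1 - node 1 (S m) a))%C by ring.
  rewrite E. ring. }
assert (Z := geometric_sum (node 1 (S m) a) m).
rewrite node_pow, pow1, node_full_turn in Z by lia.
replace (1 - 1)%C with (RtoC 0) in Z by ring.
assert (Z0 : sum_n (Cpow (node 1 (S m) a)) m = RtoC 0).
{ rewrite <- (Cmult_1_l (sum_n _ m)), <- (Cinv_l _ Hne), <- Cmult_assoc.
  etransitivity; [apply (f_equal (Cmult _)); exact Z|]. apply Cmult_0_r. }
etransitivity; [apply (f_equal (scal _)); exact Z0|]. apply Cmult_0_r.
Qed.

Lemma Csum_minus (u v : nat -> C) (m : nat) :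
  (sum_n (fun j => u j - v j) m = sum_n u m - sum_n v m)%C.
Proof.
induction m as [|m IH]; [now rewrite !sum_O|].
rewrite !sum_Sn, IH. change plus with Cplus. cring.
Qed.

(** Expanding [(1 - l)^b] leaves only powers of [l] with exponents from [a + 1] to [a + b + 1 <= m],
    each of which sums to zero. *)
Lemma node_moment (r : R) (m a b : nat) : (a + b < m)%nat ->
  sum_n (fun j => Cpow (node r (S m) j) (S a) * Cpow (1 - node r (S m) j) b)%C m = RtoC 0.
Proof.
revert a; induction b as [|b IH]; intros a Hab.
- rewrite <- (node_power_sum r m (S a)) by lia.
  apply sum_n_ext; intros j. apply Cmult_1_r.
- rewrite (sum_n_ext _ (fun j =>
     Cpow (node r (S m) j) (S a) * Cpow (1 - node r (S m) j) b
     - Cpow (node r (S m) j) (S (S a)) * Cpow (1 - node r (S m) j) b)%C).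
  + rewrite Csum_minus, !IH by lia. cring.
  + intros j. rewrite !Cpow_S.
    cring.
Qed.

(** * Bounded operators and resolvents *)

(* Instances at [X] of the lemmas on modules: their canonical structures are not
   found by unification when rewriting in a [NormedModule C_AbsRing]. *)
Lemma scal_distr_l_C {X : NormedModule C_AbsRing} (c : C) (x y : X) :
  scal c (plus x y) = (plus (scal c x) (scal c y) : X).
Proof. exact (scal_distr_l (K := C_Ring) c x y). Qed.

Lemma scal_distr_r_C {X : NormedModule C_AbsRing} (c d : C) (x : X) :
  scal (c + d)%C x = (plus (scal c x) (scal d x) : X).
Proof. exact (scal_distr_r (K := C_Ring) c d x). Qed.

Lemma scal_assoc_C {X : NormedModule C_AbsRing} (c d : C) (x : X) :
  scal c (scal d x) = scal (c * d)%C x.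
Proof. exact (scal_assoc (K := C_Ring) c d x). Qed.

Lemma scal_one_C {X : NormedModule C_AbsRing} (x : X) : scal (RtoC 1) x = x.
Proof. exact (scal_one (K := C_Ring) x). Qed.

Lemma linear_scal_C {X : NormedModule C_AbsRing} (T : X -> X) (c : C) (x : X) :
  is_linear T -> T (scal c x) = scal c (T x).
Proof. intros HT. exact (linear_scal T HT c x). Qed.

Lemma minus_add {X : NormedModule C_AbsRing} (x y : X) : plus (minus x y) y = x.
Proof.
unfold minus. rewrite <- plus_assoc.
transitivity (plus x zero); [apply f_equal, (plus_opp_l y)|apply plus_zero_r].
Qed.

Lemma add_minus {X : NormedModule C_AbsRing} (x y : X) : plus x (minus y x) = y.
Proof. rewrite plus_comm. apply minus_add. Qed.

Lemma minus_eq {X : NormedModule C_AbsRing} (x y z : X) : x = plus y z -> minus x y = z.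
Proof.
intros ->. unfold minus. rewrite (plus_comm y), <- plus_assoc.
transitivity (plus z zero); [apply f_equal, (plus_opp_r y)|apply plus_zero_r].
Qed.

Lemma norm_scal_C {X : NormedModule C_AbsRing} (c : C) (x : X) :
  norm (scal c x) <= Cmod c * norm x.
Proof. exact (norm_scal (K := C_AbsRing) c x). Qed.

Lemma opnorm_nonneg {X : NormedModule C_AbsRing} (T : X -> X) :
  is_linear T -> 0 <= opnorm T.
Proof.
intros HT. destruct (opnorm_is_lub T HT) as [ub _].
apply ub. exists zero. rewrite (linear_zero T HT), !norm_zero. split; [lra|reflexivity].
Qed.

Lemma norm_le_opnorm {X : NormedModule C_AbsRing} (T : X -> X) :
  is_linear T -> forall x, norm (T x) <= opnorm T * norm x.
Proof.
intros HT x. destruct (opnorm_is_lub T HT) as [ub _].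
destruct (Req_dec (norm x) 0) as [H0|H0].
- rewrite (norm_eq_zero x H0), (linear_zero T HT), norm_zero. lra.
- pose proof (norm_ge_0 x) as Hx.
  set (c := norm x) in *. set (y := scal (RtoC (/ c)) x).
  assert (Hy : norm y <= 1).
  { unfold y. eapply Rle_trans; [apply norm_scal_C|].
    rewrite Cmod_R, Rabs_pos_eq.
    - fold c. rewrite Rinv_l; lra.
    - left. apply Rinv_0_lt_compat; lra. }
  assert (E : x = scal (RtoC c) y).
  { unfold y. rewrite scal_assoc_C, <- RtoC_mult, Rinv_r by assumption.
    symmetry. apply scal_one_C. }
  rewrite E, (linear_scal_C T _ _ HT).
  eapply Rle_trans; [apply norm_scal_C|].
  rewrite Cmod_R, Rabs_pos_eq, Rmult_comm by assumption.
  apply Rmult_le_compat_r; [assumption|]. apply ub. now exists y.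
Qed.

Lemma opnorm_le {X : NormedModule C_AbsRing} (T : X -> X) (M : R) :
  is_linear T -> 0 <= M -> (forall x, norm (T x) <= M * norm x) -> opnorm T <= M.
Proof.
intros HT HM H. destruct (opnorm_is_lub T HT) as [_ lub].
apply lub. intros y [x [Hx ->]]. pose proof (H x). nra.
Qed.

Lemma is_linear_add {X : NormedModule C_AbsRing} (S T : X -> X) :
  is_linear S -> is_linear T -> is_linear (fun x => plus (S x) (T x)).
Proof.
intros HS HT.
exact (is_linear_comp _ _ (is_linear_prod _ _ HS HT) is_linear_plus).
Qed.

Lemma is_linear_scale {X : NormedModule C_AbsRing} (c : C) (T : X -> X) :
  is_linear T -> is_linear (fun x => scal c (T x)).
Proof.
intros HT. exact (is_linear_comp _ _ HT (is_linear_scal_r c Cmult_comm)).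
Qed.

Lemma is_linear_scalar_minus {X : NormedModule C_AbsRing} (c : C) (T : X -> X) :
  is_linear T -> is_linear (scalar_minus c T).
Proof.
intros HT. apply is_linear_add.
- apply is_linear_scale, is_linear_id.
- exact (is_linear_comp _ _ HT is_linear_opp).
Qed.

Lemma is_linear_oppow {X : NormedModule C_AbsRing} (T : X -> X) (n : nat) :
  is_linear T -> is_linear (oppow T n).
Proof.
intros HT. induction n as [|n IH]; [exact is_linear_id|].
exact (is_linear_comp _ _ IH HT).
Qed.

Lemma is_linear_sum_n {X : NormedModule C_AbsRing} (F : nat -> X -> X) (m : nat) :
  (forall j, is_linear (F j)) -> is_linear (fun x => sum_n (fun j => F j x) m).
Proof.
intros HF. induction m as [|m IH].
- apply (is_linear_ext (F O)); [|apply HF]. intros x. now rewrite sum_O.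
- apply (is_linear_ext (fun x => plus (sum_n (fun j => F j x) m) (F (S m) x))).
  + intros x. now rewrite sum_Sn.
  + now apply is_linear_add.
Qed.

Lemma linear_sum_n {X : NormedModule C_AbsRing} (T : X -> X) (v : nat -> X) (m : nat) :
  is_linear T -> T (sum_n v m) = sum_n (fun j => T (v j)) m.
Proof.
intros HT. induction m as [|m IH]; [now rewrite !sum_O|].
now rewrite !sum_Sn, (linear_plus T HT), IH.
Qed.

Lemma sum_n_scal_r {X : NormedModule C_AbsRing} (c : nat -> C) (x : X) (m : nat) :
  sum_n (fun j => scal (c j) x) m = scal (sum_n c m) x.
Proof.
induction m as [|m IH]; [now rewrite !sum_O|].
rewrite !sum_Sn, IH. symmetry. apply scal_distr_r_C.
Qed.

(** [sum_n] includes its upper index, so [m] stands for [N = S m] points. *)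
Definition mean {X : NormedModule C_AbsRing} (m : nat) (v : nat -> X) : X :=
  scal (RtoC (/ INR (S m))) (sum_n v m).

Lemma norm_mean_le {X : NormedModule C_AbsRing} (m : nat) (v : nat -> X) (B : nat -> R) :
  (forall j, (j <= m)%nat -> norm (v j) <= B j) ->
  norm (mean m v) <= / INR (S m) * sum_n B m.
Proof.
intros H. unfold mean. eapply Rle_trans; [apply norm_scal_C|].
assert (Hm : 0 < INR (S m)) by (apply lt_0_INR; lia).
rewrite Cmod_R, Rabs_pos_eq by (left; now apply Rinv_0_lt_compat).
apply Rmult_le_compat_l; [left; now apply Rinv_0_lt_compat|].
revert H. clear Hm. induction m as [|m IH]; intros H.
- rewrite !sum_O. apply H; lia.
- rewrite !sum_Sn. eapply Rle_trans; [apply norm_triangle|].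
  apply Rplus_le_compat; [|apply H; lia]. apply IH. intros j Hj. apply H; lia.
Qed.

Lemma norm_mean_le_const {X : NormedModule C_AbsRing} (m : nat) (v : nat -> X) (B : R) :
  (forall j, (j <= m)%nat -> norm (v j) <= B) -> norm (mean m v) <= B.
Proof.
intros H. eapply Rle_trans; [exact (norm_mean_le m v (fun _ => B) H)|].
rewrite sum_n_const, <- Rmult_assoc, Rinv_l; [lra|]. apply not_0_INR; lia.
Qed.

Lemma resolvent_is_inverse {X : NormedModule C_AbsRing} (T : X -> X) (l : C) :
  spectrum_in_closed_disk T -> 1 < Cmod l ->
  is_inverse (scalar_minus l T) (resolvent l T).
Proof.
intros Hsp Hl. apply resolventP. intros H. pose proof (Hsp l H). lra.
Qed.

Lemma scal_resolvent {X : NormedModule C_AbsRing} (T : X -> X) (l : C) (x : X) :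
  is_inverse (scalar_minus l T) (resolvent l T) ->
  scal l (resolvent l T x) = plus x (T (resolvent l T x)).
Proof.
intros [_ [_ H]]. rewrite <- (H x) at 2. symmetry.
apply minus_add.
Qed.

(** Since [T] commutes with [l - T], the vector [T (R x)] is mapped to [T x] by [l - T]. *)
Lemma resolvent_commute {X : NormedModule C_AbsRing} (T : X -> X) (l : C) (x : X) :
  is_linear T -> is_inverse (scalar_minus l T) (resolvent l T) ->
  resolvent l T (T x) = T (resolvent l T x).
Proof.
intros HT [HR [H1 H2]]. rewrite <- (H1 (T (resolvent l T x))). f_equal.
rewrite <- (H2 x) at 1. unfold scalar_minus.
now rewrite (linear_minus T _ _ HT), (linear_scal_C T _ _ HT).
Qed.

(** For [y = R(u,T) x] one has [(l - T) y = x + (l - u) y]; applying [R(l,T)] gives the identity. *)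
Lemma resolvent_identity {X : NormedModule C_AbsRing} (T : X -> X) (l u : C) (x : X) :
  is_inverse (scalar_minus l T) (resolvent l T) ->
  is_inverse (scalar_minus u T) (resolvent u T) ->
  minus (resolvent u T x) (resolvent l T x)
    = scal (l - u)%C (resolvent l T (resolvent u T x)).
Proof.
intros [HR [H1 _]] [_ [_ H2]].
set (y := resolvent u T x).
assert (E : scalar_minus l T y = plus x (scal (l - u)%C y)).
{ rewrite <- (H2 x). fold y. unfold scalar_minus.
  replace l with ((l - u) + u)%C at 1 by ring.
  rewrite scal_distr_r_C.
  unfold minus. rewrite <- plus_assoc. apply plus_comm. }
rewrite <- (H1 y) at 1. rewrite E, (linear_plus _ HR), (linear_scal_C _ _ _ HR).
now apply minus_eq.
Qed.

(** By the resolvent identity, [y = R(u,T) x] satisfies [|y| <= M |x| + |l - u| M |y|], and the last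
    term is at most [|y| / 2], hence absorbed on the left. *)
Lemma resolvent_perturbation {X : NormedModule C_AbsRing} (T : X -> X) (l u : C) (M : R) :
  is_inverse (scalar_minus l T) (resolvent l T) ->
  is_inverse (scalar_minus u T) (resolvent u T) ->
  (forall x, norm (resolvent l T x) <= M * norm x) -> Cmod (l - u)%C * M <= 1 / 2 ->
  forall x, norm (resolvent u T x) <= 2 * M * norm x.
Proof.
intros Hl Hu HM Hlu x.
set (y := resolvent u T x).
assert (E : norm y <= norm (resolvent l T x) + Cmod (l - u)%C * (M * norm y)).
{ pose proof (resolvent_identity T l u x Hl Hu) as Hid. fold y in Hid.
  replace y with (plus (resolvent l T x) (minus y (resolvent l T x))) at 1.
  - eapply Rle_trans; [apply norm_triangle|]. apply Rplus_le_compat_l.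
    rewrite Hid. eapply Rle_trans; [apply norm_scal_C|].
    apply Rmult_le_compat_l; [apply Cmod_ge_0|apply HM].
  - apply add_minus. }
pose proof (HM x). pose proof (norm_ge_0 y). nra.
Qed.

(** * Discretized contour integrals *)

(* Discretization of the contour integral of [l^a (1-l)^b R(l,T)] over [|l| = r];
   the extra factor [l] comes from [dl = i l dt]. *)
Definition contour {X : NormedModule C_AbsRing} (T : X -> X) (r : R) (m a b : nat)
    (x : X) : X :=
  mean m (fun j =>
    scal (Cpow (node r (S m) j) (S a) * Cpow (1 - node r (S m) j) b)%C
      (resolvent (node r (S m) j) T x)).

Lemma node_resolvent {X : NormedModule C_AbsRing} (T : X -> X) (r : R) (N j : nat) :
  spectrum_in_closed_disk T -> 1 < r ->
  is_inverse (scalar_minus (node r N j) T) (resolvent (node r N j) T).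
Proof.
intros Hsp Hr. apply resolvent_is_inverse; [assumption|].
unfold node. rewrite Cmod_polar; lra.
Qed.

Lemma is_linear_contour {X : NormedModule C_AbsRing} (T : X -> X) (r : R) (m a b : nat) :
  spectrum_in_closed_disk T -> 1 < r -> is_linear (contour T r m a b).
Proof.
intros Hsp Hr. apply is_linear_scale.
apply (is_linear_sum_n (fun j x =>
    scal (Cpow (node r (S m) j) (S a) * Cpow (1 - node r (S m) j) b)%C
      (resolvent (node r (S m) j) T x))).
intros j. apply is_linear_scale, node_resolvent; assumption.
Qed.

(** At each node [l R(l,T) = I + T R(l,T)]: one more factor [l] amounts to an application of [T],
    plus a scalar moment of the nodes. *)
Lemma contour_succ_l {X : NormedModule C_AbsRing} (T : X -> X) (r : R) (m a b : nat) (x : X) :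
  is_linear T -> spectrum_in_closed_disk T -> 1 < r ->
  contour T r m (S a) b x
    = (plus (scal (RtoC (/ INR (S m)))
              (scal (sum_n (fun j =>
                Cpow (node r (S m) j) (S a) * Cpow (1 - node r (S m) j) b)%C m) x))
        (T (contour T r m a b x)) : X).
Proof.
intros HT Hsp Hr. unfold contour, mean.
rewrite (linear_scal_C T _ _ HT), (linear_sum_n T _ _ HT), <- sum_n_scal_r.
rewrite <- scal_distr_l_C, <- sum_n_plus.
f_equal. apply sum_n_ext; intros j.
rewrite (linear_scal_C T _ _ HT).
etransitivity; [|apply scal_distr_l_C].
rewrite <- (scal_resolvent T) by now apply node_resolvent.
rewrite scal_assoc_C. f_equal.
rewrite (Cpow_S _ (S a)). cring.
Qed.

Lemma contour_succ_r {X : NormedModule C_AbsRing} (T : X -> X) (r : R) (m a b : nat) (x : X) :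
  contour T r m a (S b) x = minus (contour T r m a b x) (contour T r m (S a) b x).
Proof.
symmetry. apply minus_eq. unfold contour, mean.
etransitivity; [|apply scal_distr_l_C].
f_equal. etransitivity; [|apply (sum_n_plus (G := NormedModule.AbelianMonoid _ X))].
apply sum_n_ext; intros j.
etransitivity; [|apply scal_distr_r_C]. f_equal. change plus with Cplus.
rewrite !Cpow_S. cring.
Qed.

(** In this range of degrees the moments of [contour_succ_l] vanish, so each [l] is traded for [T]
    and each [1 - l] for [I - T] without discretization error. *)
Lemma contour_poly {X : NormedModule C_AbsRing} (T : X -> X) (r : R) (m a b : nat) (x : X) :
  is_linear T -> spectrum_in_closed_disk T -> 1 < r -> (a + b <= m)%nat ->
  contour T r m a b x
    = opcomp (oppow T a) (oppow (scalar_minus 1 T) b) (contour T r m 0 0 x).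
Proof.
intros HT Hsp Hr.
assert (Hl : forall a b, (a + b < m)%nat ->
  contour T r m (S a) b x = T (contour T r m a b x)).
{ intros a' b' Hab. rewrite contour_succ_l, node_moment by assumption.
  rewrite (scal_zero_l (K := C_Ring)), scal_zero_r. apply plus_zero_l. }
induction a as [|a IHa]; intros Hab.
- induction b as [|b IHb]; [reflexivity|].
  rewrite contour_succ_r, Hl, IHb by lia. unfold opcomp.
  set (y := oppow _ b _).
  change (minus y (T y) = minus (scal (RtoC 1) y) (T y)).
  now rewrite scal_one_C.
- rewrite Hl, IHa by lia. reflexivity.
Qed.

(** Both sides compute [contour T r m (S m) 0 x]: directly, because [l^(S m) = r^(S m)] at every
    node, and through [contour_succ_l], whose moment is now [r^(S m)] instead of zero. *)
Lemma contour_full_turn {X : NormedModule C_AbsRing} (T : X -> X) (r : R) (m : nat) (x : X) :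
  is_linear T -> spectrum_in_closed_disk T -> 1 < r ->
  scal (RtoC (r ^ S m)) (contour T r m 0 0 x)
    = plus (scal (RtoC (r ^ S m)) x) (oppow T (S m) (contour T r m 0 0 x)).
Proof.
intros HT Hsp Hr.
assert (Hpow : forall j, Cpow (node r (S m) j) (S m) = RtoC (r ^ S m)).
{ intros j. rewrite node_pow. apply node_full_turn; lia. }
transitivity (contour T r m (S m) 0 x).
- unfold contour, mean.
  rewrite scal_assoc_C, Cmult_comm, <- scal_assoc_C.
  f_equal.
  rewrite (linear_sum_n (fun y : X => scal (RtoC (r ^ S m)) y))
    by apply is_linear_scale, is_linear_id.
  apply sum_n_ext; intros j.
  rewrite scal_assoc_C. f_equal.
  rewrite (Cpow_S _ (S m)), Hpow, Cpow_1_r. cring.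
- rewrite contour_succ_l, contour_poly by (assumption || lia). f_equal.
  rewrite (sum_n_ext _ (fun _ => RtoC (r ^ S m))).
  2: { intros j. rewrite Hpow. apply Cmult_1_r. }
  rewrite scal_assoc_C. f_equal.
  assert (E : forall (c : C) n, sum_n (fun _ => c) n = (RtoC (INR (S n)) * c)%C).
  { intros c n. induction n as [|n IH].
    - rewrite sum_O. simpl. symmetry. apply Cmult_1_l.
    - rewrite sum_Sn, IH, (S_INR (S n)), RtoC_plus. change plus with Cplus. cring. }
  rewrite E. rewrite Cmult_assoc, <- RtoC_mult, Rinv_l.
  + apply Cmult_1_l.
  + apply not_0_INR; lia.
Qed.

Lemma contour_oppow_commute {X : NormedModule C_AbsRing} (T : X -> X) (r : R) (m n : nat) (x : X) :
  is_linear T -> spectrum_in_closed_disk T -> 1 < r ->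
  contour T r m 0 0 (oppow T n x) = oppow T n (contour T r m 0 0 x).
Proof.
intros HT Hsp Hr. induction n as [|n IH]; [reflexivity|].
change (oppow T (S n)) with (fun x => T (oppow T n x)). cbn beta. rewrite <- IH.
unfold contour, mean. rewrite (linear_scal_C T _ _ HT), (linear_sum_n T _ _ HT).
f_equal. apply sum_n_ext; intros j.
rewrite (linear_scal_C T _ _ HT). f_equal.
apply resolvent_commute; [assumption|]. now apply node_resolvent.
Qed.

(** * The spectral radius *)

(** Around each angle [u] the perturbation lemma gives the bound [2 K(u)] on an interval of radius
    [1 / (2 r K(u))]. Compactness of [[0, 2 PI]] allows only centres [u] whose radius is at least a
    fixed [d], that is [2 K(u) <= 1 / (r d)]. *)
Lemma resolvent_bounded_on_circle {X : NormedModule C_AbsRing} (T : X -> X) (r : R) :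
  spectrum_in_closed_disk T -> 1 < r ->
  exists M, 0 < M /\ forall t, 0 <= t <= 2 * PI ->
    forall x, norm (resolvent (polar r t) T x) <= M * norm x.
Proof.
intros Hsp Hr.
assert (Hinv : forall t, is_inverse (scalar_minus (polar r t) T) (resolvent (polar r t) T)).
{ intros t. apply resolvent_is_inverse; [assumption|]. rewrite Cmod_polar; lra. }
(* Adding [1] keeps [K] positive even when the operator norm is zero. *)
set (K := fun t => opnorm (resolvent (polar r t) T) + 1).
assert (HK : forall t, 0 < K t).
{ intros t. pose proof (opnorm_nonneg _ (proj1 (Hinv t))). unfold K; lra. }
assert (Hd : forall t, 0 < / (2 * r * K t)).
{ intros t. apply Rinv_0_lt_compat. pose proof (HK t). nra. }
destruct (compactness_value_1d 0 (2 * PI) (fun t => mkposreal _ (Hd t))) as [d Hcov].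
pose proof (cond_pos d) as Hd0.
exists (/ (r * d)). split; [apply Rinv_0_lt_compat; nra|].
intros t Ht. apply NNPP; intros Hn. apply (Hcov t Ht). intros [u [Hu [Htu Hdu]]]. apply Hn.
clear Hn Hcov. cbn [pos] in *. pose proof (HK u) as HKu.
assert (HuK : d * (2 * r * K u) <= 1).
{ apply Rmult_le_reg_l with (/ (2 * r * K u)); [apply Hd|].
  field_simplify; [|lra|lra]. unfold Rdiv in *. rewrite Rmult_1_l.
  field_simplify in Hdu; lra. }
intros x.
apply Rle_trans with (2 * K u * norm x).
- apply (resolvent_perturbation T (polar r u)); try apply Hinv.
  + intros y. pose proof (norm_le_opnorm _ (proj1 (Hinv u)) y). pose proof (norm_ge_0 y).
    unfold K. lra.
  + assert (Habs : Rabs (u - t) * (2 * r * K u) <= 1).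
    { rewrite Rabs_minus_sym.
      apply Rle_trans with (/ (2 * r * K u) * (2 * r * K u)).
      - apply Rmult_le_compat_r; [nra|lra].
      - rewrite Rinv_l; nra. }
    pose proof (Cmod_polar_minus_angle r u t ltac:(lra)). nra.
- apply Rmult_le_compat_r; [apply norm_ge_0|].
  apply Rmult_le_reg_l with (r * d); [nra|]. rewrite Rinv_r; nra.
Qed.

(* [3] is the constant that [eventually_dominated_step] reproduces. *)
Definition eventually_dominated {X : NormedModule C_AbsRing} (T : X -> X) (r : R) : Prop :=
  exists N0, forall N, (N0 <= N)%nat -> forall x,
    norm (oppow T N x) <= 3 * r ^ N * norm x.

(** With [A = R(l,T)] and [B = R(u,T)], [l A - u B = (l - u) A + u (A - B)], and the resolvent
    identity controls [A - B]. The bound does not depend on [N] or [j]. *)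
Lemma node_resolvent_radius_variation {X : NormedModule C_AbsRing} (T : X -> X)
    (r s M : R) (N j : nat) (x : X) :
  spectrum_in_closed_disk T -> 1 < r -> 1 < s -> 0 < M ->
  (forall y, norm (resolvent (node r N j) T y) <= M * norm y) ->
  (forall y, norm (resolvent (node s N j) T y) <= M * norm y) ->
  norm (minus (scal (node r N j) (resolvent (node r N j) T x))
              (scal (node s N j) (resolvent (node s N j) T x)))
    <= Rabs (r - s) * (M + s * M ^ 2) * norm x.
Proof.
intros Hsp Hr Hs HM Br Bs.
set (l := node r N j) in *. set (u := node s N j) in *.
set (A := resolvent l T) in *. set (B := resolvent u T) in *.
assert (Hlu : Cmod (l - u)%C = Rabs (r - s)) by apply Cmod_polar_minus_radius.
assert (Hu : Cmod u = s) by (unfold u, node; apply Cmod_polar; lra).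
assert (E : minus (scal l (A x)) (scal u (B x))
  = (plus (scal (l - u)%C (A x)) (scal u (minus (A x) (B x))) : X)).
{ apply minus_eq. rewrite plus_comm, <- plus_assoc.
  transitivity (plus (scal (l - u)%C (A x)) (scal u (A x)) : X).
  - rewrite <- scal_distr_r_C. f_equal. ring.
  - apply (f_equal (plus _)). rewrite <- (minus_add (A x) (B x)) at 1. apply scal_distr_l_C. }
rewrite E.
assert (Hid : minus (A x) (B x) = scal (u - l)%C (B (A x))).
{ apply resolvent_identity; now apply node_resolvent. }
eapply Rle_trans; [apply (norm_triangle (V := X))|].
assert (H1 : norm (scal (l - u)%C (A x)) <= Rabs (r - s) * (M * norm x)).
{ eapply Rle_trans; [apply norm_scal_C|]. rewrite Hlu.
  apply Rmult_le_compat_l; [apply Rabs_pos|apply Br]. }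
assert (H2 : norm (scal u (minus (A x) (B x))) <= s * (Rabs (r - s) * (M * (M * norm x)))).
{ eapply Rle_trans; [apply norm_scal_C|]. rewrite Hu.
  apply Rmult_le_compat_l; [lra|]. rewrite Hid.
  eapply Rle_trans; [apply norm_scal_C|].
  rewrite <- (Cmod_opp (u - l)). replace (- (u - l))%C with (l - u)%C by ring. rewrite Hlu.
  apply Rmult_le_compat_l; [apply Rabs_pos|].
  eapply Rle_trans; [apply Bs|]. apply Rmult_le_compat_l; [lra|apply Br]. }
lra.
Qed.

Lemma norm_contour_00_le {X : NormedModule C_AbsRing} (T : X -> X) (r M : R) (m : nat) (x : X) :
  0 <= r -> (forall j, (j <= m)%nat ->
    forall y, norm (resolvent (node r (S m) j) T y) <= M * norm y) ->
  norm (contour T r m 0 0 x) <= r * M * norm x.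
Proof.
intros Hr HM. apply norm_mean_le_const. intros j Hj.
eapply Rle_trans; [apply norm_scal_C|].
rewrite Cmod_mult, !Cmod_pow. unfold node at 1. rewrite Cmod_polar by assumption.
simpl pow. rewrite !Rmult_1_r, Rmult_assoc.
apply Rmult_le_compat_l; [assumption|]. now apply HM.
Qed.

Lemma contour_00_minus_id {X : NormedModule C_AbsRing} (T : X -> X) (r : R) (m : nat) (x : X) :
  is_linear T -> spectrum_in_closed_disk T -> 1 < r ->
  r ^ S m * norm (minus (contour T r m 0 0 x) x)
    <= norm (oppow T (S m) (contour T r m 0 0 x)).
Proof.
intros HT Hsp Hr. set (y := contour T r m 0 0 x).
assert (Hp : 0 < r ^ S m) by (apply pow_lt; lra).
assert (E : minus y x = scal (RtoC (/ r ^ S m)) (oppow T (S m) y)).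
{ apply minus_eq. rewrite <- (scal_one_C y) at 1. rewrite <- (scal_one_C x).
  rewrite <- (Rinv_l (r ^ S m)) by lra. rewrite RtoC_mult, <- !scal_assoc_C.
  unfold y at 1. rewrite contour_full_turn by assumption. apply scal_distr_l_C. }
rewrite E.
apply Rmult_le_reg_l with (/ r ^ S m); [now apply Rinv_0_lt_compat|].
rewrite <- Rmult_assoc, Rinv_l, Rmult_1_l by lra.
eapply Rle_trans; [apply norm_scal_C|].
rewrite Cmod_R, Rabs_pos_eq; [lra|]. left; now apply Rinv_0_lt_compat.
Qed.

Lemma geometric_eventually_small (q e : R) : 0 <= q < 1 -> 0 < e ->
  exists N0, forall N, (N0 <= N)%nat -> q ^ N <= e.
Proof.
intros Hq He.
destruct (pow_lt_1_zero q) with (y := e) as [N0 H]; [rewrite Rabs_pos_eq; lra|assumption|].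
exists N0. intros N HN. pose proof (H N HN). pose proof (Rle_abs (q ^ N)). lra.
Qed.

(** With [S] the contour mean over [N = S m] points, [S - I = r^(-N) T^N S] has norm at most
    [3 (s / r)^N r M], which tends to zero. *)
Lemma contour_00_converges {X : NormedModule C_AbsRing} (T : X -> X) (r s M e : R) :
  is_linear T -> spectrum_in_closed_disk T -> 1 < r -> 0 < s < r -> 0 < M -> 0 < e ->
  eventually_dominated T s ->
  (forall N j, (j <= N)%nat ->
    forall y, norm (resolvent (node r N j) T y) <= M * norm y) ->
  exists N0, forall m, (N0 <= m)%nat -> forall x,
    norm (minus (contour T r m 0 0 x) x) <= e * norm x.
Proof.
intros HT Hsp Hr Hs HM He [N1 Hdom] HR.
assert (Hrm : 0 < 3 * (r * M)) by nra.
destruct (geometric_eventually_small (s / r) (e / (3 * (r * M)))) as [N2 Hq].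
{ split; [apply Rdiv_le_0_compat; lra|].
  apply Rmult_lt_reg_r with r; [lra|]. unfold Rdiv. rewrite Rmult_assoc, Rinv_l; lra. }
{ apply Rdiv_lt_0_compat; lra. }
exists (N1 + N2)%nat. intros m Hm x.
specialize (Hq (S m) ltac:(lia)).
assert (Hp : 0 < r ^ S m) by (apply pow_lt; lra).
assert (E : s ^ S m = (s / r) ^ S m * r ^ S m).
{ rewrite <- Rpow_mult_distr. f_equal. field. lra. }
apply Rmult_le_reg_l with (r ^ S m); [assumption|].
eapply Rle_trans; [now apply contour_00_minus_id|].
eapply Rle_trans; [apply Hdom; lia|].
assert (Hc := norm_contour_00_le T r M m x ltac:(lra) (fun j Hj => HR (S m) j ltac:(lia))).
assert (Hs0 : 0 < s ^ S m) by (apply pow_lt; lra).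
apply Rle_trans with (3 * s ^ S m * (r * M * norm x)).
{ apply Rmult_le_compat_l; [lra|assumption]. }
rewrite E. pose proof (norm_ge_0 x).
apply Rle_trans with (r ^ S m * norm x * (3 * (r * M) * (s / r) ^ S m)); [lra|].
apply Rle_trans with (r ^ S m * norm x * e); [|lra].
apply Rmult_le_compat_l; [nra|].
apply Rmult_le_compat_l with (r := 3 * (r * M)) in Hq; [|lra].
eapply Rle_trans; [exact Hq|]. right. field. split; lra.
Qed.

(** For large [N = S m] the contour mean [S] at radius [r] is within [1/4] of the one at [r'],
    itself within [1/4] of [I]. So [|y| <= 2 |S y|]. As [S (r^N - T^N) = r^N I], this gives
    [|(r^N - T^N) x| <= 2 r^N |x|], hence [|T^N x| <= 3 r^N |x|]. *)
Lemma eventually_dominated_step {X : NormedModule C_AbsRing} (T : X -> X) (r r' s M : R) :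
  is_linear T -> spectrum_in_closed_disk T -> 1 < r <= r' -> 0 < s < r' -> 0 < M ->
  (r' - r) * (M + r' * M ^ 2) <= 1 / 4 ->
  (forall N j, (j <= N)%nat ->
    forall y, norm (resolvent (node r N j) T y) <= M * norm y) ->
  (forall N j, (j <= N)%nat ->
    forall y, norm (resolvent (node r' N j) T y) <= M * norm y) ->
  eventually_dominated T s -> eventually_dominated T r.
Proof.
intros HT Hsp Hr Hs HM Hclose HR HR' Hdom.
destruct (contour_00_converges T r' s M (1 / 4)) as [N0 Hconv]; try assumption; try lra.
exists (S N0). intros [|m] HN x; [lia|].
assert (Hvar : forall x, norm (minus (contour T r m 0 0 x) (contour T r' m 0 0 x))
  <= 1 / 4 * norm x).
{ clear x. intros x.
  replace (minus (contour T r m 0 0 x) (contour T r' m 0 0 x)) with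
    (mean m (fun j => minus
      (scal (node r (S m) j) (resolvent (node r (S m) j) T x))
      (scal (node r' (S m) j) (resolvent (node r' (S m) j) T x)))).
  - apply norm_mean_le_const. intros j Hj.
    eapply Rle_trans.
    + apply (node_resolvent_radius_variation T r r' M); try assumption; try lra;
        [apply HR|apply HR']; lia.
    + apply Rmult_le_compat_r; [apply norm_ge_0|].
      rewrite Rabs_minus_sym, Rabs_pos_eq; lra.
  - symmetry. apply minus_eq. unfold contour, mean.
    etransitivity; [|apply scal_distr_l_C]. apply f_equal.
    etransitivity; [|apply sum_n_plus]. apply sum_n_ext; intros j.
    assert (Ew : forall w : C, (Cpow w 1 * Cpow (1 - w) 0)%C = w).
    { intros w. rewrite Cpow_1_r. apply Cmult_1_r. }
    rewrite !Ew. symmetry. apply add_minus. }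
assert (Hnear : forall x, norm (minus (contour T r m 0 0 x) x) <= 1 / 2 * norm x).
{ clear x. intros x.
  replace (minus (contour T r m 0 0 x) x) with
    (plus (minus (contour T r m 0 0 x) (contour T r' m 0 0 x))
          (minus (contour T r' m 0 0 x) x)).
  - eapply Rle_trans; [apply (norm_triangle (V := X))|].
    pose proof (Hvar x). pose proof (Hconv m ltac:(lia) x). lra.
  - symmetry. apply minus_eq. rewrite (plus_comm (minus (contour T r m 0 0 x) _)), plus_assoc.
    now rewrite !add_minus. }
set (c := RtoC (r ^ S m)). set (S' := contour T r m 0 0) in *.
assert (HS : is_linear S') by (apply is_linear_contour; [assumption|lra]).
set (z := oppow T (S m) x). set (y := minus (scal c x) z).
assert (Hc : Cmod c = r ^ S m).
{ unfold c. rewrite Cmod_R. apply Rabs_pos_eq, pow_le. lra. }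
assert (Sy : S' y = scal c x).
{ unfold y. rewrite (linear_minus _ _ _ HS), (linear_scal_C _ _ _ HS).
  apply minus_eq. unfold z, S'. rewrite contour_oppow_commute by (assumption || lra).
  rewrite plus_comm. apply contour_full_turn; [assumption|assumption|lra]. }
assert (Hcx : norm (scal c x) <= r ^ S m * norm x).
{ rewrite <- Hc. apply norm_scal_C. }
assert (Hy : norm y <= 2 * norm (scal c x)).
{ rewrite <- Sy. pose proof (Hnear y) as Hny.
  assert (norm y <= norm (minus (S' y) y) + norm (S' y)); [|lra].
  rewrite <- (norm_opp (minus (S' y) y)), opp_minus.
  rewrite <- (minus_add y (S' y)) at 1. apply (norm_triangle (V := X)). }
assert (Hz : norm z <= norm y + norm (scal c x));
  [|rewrite Rmult_assoc; lra].
replace z with (minus (scal c x) y).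
- unfold minus. rewrite Rplus_comm, <- (norm_opp y). apply (norm_triangle (V := X)).
- apply minus_eq. unfold y. symmetry. apply minus_add.
Qed.

Lemma oppow_norm_le {X : NormedModule C_AbsRing} (T : X -> X) (L : R) (n : nat) :
  0 <= L -> (forall x, norm (T x) <= L * norm x) ->
  forall x, norm (oppow T n x) <= L ^ n * norm x.
Proof.
intros HL HT x. induction n as [|n IH]; simpl; [lra|].
eapply Rle_trans; [apply HT|]. rewrite Rmult_assoc. now apply Rmult_le_compat_l.
Qed.

Lemma node_angle (N j : nat) : (j <= N)%nat -> 0 <= 2 * PI * INR j / INR N <= 2 * PI.
Proof.
intros Hj. pose proof PI_RGT_0 as HP. pose proof (pos_INR j) as Hj0.
destruct (Nat.eq_dec N 0) as [->|HN].
- replace j with O by lia. simpl. rewrite Rmult_0_r, Rdiv_0_l. lra.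
- apply le_INR in Hj. assert (0 < INR N) by (apply lt_0_INR; lia).
  split; [apply Rdiv_le_0_compat; nra|].
  apply Rmult_le_reg_r with (INR N); [lra|].
  unfold Rdiv. rewrite Rmult_assoc, Rinv_l by lra. nra.
Qed.

(* Rickart's argument: at the infimum [rho > 1] of the dominated radii, the resolvent
   is bounded near the circle of radius [rho], and the discretized contour integrals
   of all orders vary little across that circle. *)
Lemma spectral_radius_le_1 {X : NormedModule C_AbsRing} (T : X -> X) (r0 : R) :
  is_linear T -> spectrum_in_closed_disk T -> 1 < r0 -> eventually_dominated T r0.
Proof.
intros HT Hsp Hr0. apply NNPP; intros Hbad.
destruct (linear_norm T HT) as [L [HL HTL]].
(* [rho] is reached from below, as the supremum of the radii that are not dominated; this set is
   bounded by the norm bound [L] of [T]. *)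
set (B := fun r => 1 < r /\ ~ eventually_dominated T r).
assert (HLdom : forall r, L <= r -> eventually_dominated T r).
{ intros r Hr. exists O. intros N _ x.
  eapply Rle_trans; [apply oppow_norm_le with (L := L); [lra|assumption]|].
  apply Rmult_le_compat_r; [apply norm_ge_0|].
  pose proof (pow_incr L r N ltac:(lra)). pose proof (pow_le L N ltac:(lra)). lra. }
destruct (completeness B) as [rho [Hub Hlub]].
{ exists L. intros r [_ Hr]. apply Rnot_lt_le; intros H. apply Hr, HLdom. lra. }
{ exists r0. now split. }
assert (Hrho : 1 < rho).
{ apply Rlt_le_trans with r0; [assumption|]. apply Hub. now split. }
assert (Hgood : forall r, rho < r -> eventually_dominated T r).
{ intros r Hr. apply NNPP; intros Hn. assert (r <= rho); [|lra].
  apply Hub. split; [lra|assumption]. }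
destruct (resolvent_bounded_on_circle T rho Hsp Hrho) as [M0 [HM0 Hcirc]].
set (M := 2 * M0).
set (D := M + (rho + 1) * M ^ 2).
assert (HM : 0 < M) by (unfold M; lra).
assert (HD : M <= D).
{ unfold D. pose proof (pow2_ge_0 M). nra. }
(* This gives [2 e D <= 1/4], as [eventually_dominated_step] requires across a gap of at most [2 e],
   and [e M0 <= 1/2], so that the bound [M = 2 M0] holds within [e] of the circle of radius
   [rho]. *)
set (e := / (8 * D + 1)).
assert (He : 0 < e) by (apply Rinv_0_lt_compat; lra).
assert (HeD : e * (8 * D + 1) = 1) by (apply Rinv_l; lra).
assert (He1 : e <= 1) by nra.
assert (Hnear : forall r, 1 < r -> Rabs (rho - r) <= e -> forall N j, (j <= N)%nat ->
  forall y, norm (resolvent (node r N j) T y) <= M * norm y).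
{ intros r Hr Hrr N j Hj. unfold node.
  apply (resolvent_perturbation T (polar rho (2 * PI * INR j / INR N)) _ M0).
  - apply resolvent_is_inverse; [assumption|]. rewrite Cmod_polar; lra.
  - apply resolvent_is_inverse; [assumption|]. rewrite Cmod_polar; lra.
  - apply Hcirc. now apply node_angle.
  - rewrite Cmod_polar_minus_radius. unfold M in HD. nra. }
assert (Hex : exists r, B r /\ rho - e < r).
{ apply NNPP; intros Hn. assert (rho <= rho - e); [|lra]. apply Hlub.
  intros r Hr. apply Rnot_lt_le; intros H. apply Hn. now exists r. }
destruct Hex as [r [[Hr1 Hrbad] Hre]].
assert (Hrr : r <= rho) by (apply Hub; now split).
apply Hrbad.
(* The radius [rho + e / 2] is dominated because it exceeds [rho], and it is strictly below
   [rho + e], which makes the means at [rho + e] converge to [I]. *)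
apply (eventually_dominated_step T r (rho + e) (rho + e / 2) M); try assumption; try lra.
- assert ((rho + e - r) * (M + (rho + e) * M ^ 2) <= (2 * e) * D); [|nra].
  pose proof (pow2_ge_0 M). apply Rmult_le_compat; try lra.
  + nra.
  + unfold D. nra.
- apply Hnear; [assumption|]. apply Rabs_le. lra.
- apply Hnear; [lra|]. apply Rabs_le. lra.
- apply Hgood. lra.
Qed.

(** * Riemann sums of powers *)

Lemma Rpower_pos (x y : R) : 0 < Rpower x y.
Proof. apply exp_pos. Qed.

Lemma Rpower_opp_antitone (x y s : R) : 0 < x <= y -> 0 <= s ->
  Rpower y (- s) <= Rpower x (- s).
Proof.
intros H Hs. rewrite !Rpower_Ropp. apply Rinv_le_contravar; [apply Rpower_pos|].
apply Rle_Rpower_l; lra.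
Qed.

Lemma Rpower_div_base (x p : R) : 0 < x -> Rpower x (- (p + 1)) = Rpower x (- p) / x.
Proof.
intros Hx. rewrite Ropp_plus_distr, Rpower_plus, (Rpower_Ropp x 1).
now rewrite Rpower_1.
Qed.

(** Comparison of [h f(x + h)] with the integral over [[x, x + h]] of the decreasing
    [f(t) = t^(-(p+1))]. It is derived from [exp v >= 1 + v], used also to get
    [ln (x + h) - ln x >= h / (x + h)]. *)
Lemma Rpower_telescope (p x h : R) : 0 < p -> 0 < x -> 0 < h ->
  h * Rpower (x + h) (- (p + 1)) <= / p * (Rpower x (- p) - Rpower (x + h) (- p)).
Proof.
intros Hp Hx Hh. set (y := x + h).
assert (Hy : 0 < y) by (unfold y; lra).
apply Rmult_le_reg_l with p; [assumption|].
rewrite <- (Rmult_assoc p (/ p)), Rinv_r, Rmult_1_l by lra.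
rewrite Rpower_div_base by assumption.
assert (E : Rpower x (- p) = Rpower y (- p) * exp (p * (ln y - ln x))).
{ unfold Rpower. rewrite <- exp_plus. f_equal. ring. }
assert (H1 := exp_ineq1_le (p * (ln y - ln x))).
assert (H2 : h / y <= ln y - ln x).
{ assert (H3 := exp_ineq1_le (ln x - ln y)).
  unfold Rminus in H3. rewrite exp_plus, exp_Ropp, !exp_ln in H3 by assumption.
  assert (x / y = 1 - h / y) by (unfold y; field; unfold y in Hy; lra). lra. }
rewrite E. pose proof (Rpower_pos y (- p)).
apply Rle_trans with (Rpower y (- p) * (p * (h / y))); [right; field; lra|].
apply Rle_trans with (Rpower y (- p) * (exp (p * (ln y - ln x)) - 1)); [|right; ring].
apply Rmult_le_compat_l; [lra|]. nra.
Qed.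

(** The mesh [1 / N] is at most [d], so the term [j = 0] contributes at most [d^(-p)]; the others
    telescope to at most [d^(-p) / p]. *)
Lemma Riemann_sum_Rpower_le (p d : R) (N M : nat) : 0 < p -> 0 < d -> (0 < N)%nat ->
  1 <= d * INR N ->
  / INR N * sum_n (fun j => Rpower (d + INR j / INR N) (- (p + 1))) M
    <= (1 + / p) * Rpower d (- p).
Proof.
intros Hp Hd HN HdN. apply lt_0_INR in HN. set (h := / INR N).
assert (Hh : 0 < h) by now apply Rinv_0_lt_compat.
assert (Hhd : h <= d).
{ apply Rmult_le_reg_r with (INR N); [assumption|]. unfold h. rewrite Rinv_l; lra. }
assert (H : h * sum_n (fun j => Rpower (d + INR j / INR N) (- (p + 1))) M
  <= Rpower d (- p) + / p * (Rpower d (- p) - Rpower (d + INR M * h) (- p))).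
{ induction M as [|M IH].
  - rewrite sum_O. simpl INR. rewrite Rdiv_0_l, Rmult_0_l, Rplus_0_r.
    rewrite Rpower_div_base by assumption. pose proof (Rpower_pos d (- p)).
    assert (h / d <= 1).
    { apply Rmult_le_reg_r with d; [assumption|]. unfold Rdiv.
      rewrite Rmult_assoc, Rinv_l; lra. }
    apply Rle_trans with (Rpower d (- p) * (h / d)); [right; field; lra|]. nra.
  - rewrite sum_Sn. change plus with Rplus.
    assert (HM := pos_INR M).
    assert (HT := Rpower_telescope p (d + INR M * h) h Hp ltac:(nra) Hh).
    rewrite S_INR.
    replace (d + (INR M + 1) / INR N) with (d + INR M * h + h) by (unfold h; field; lra).
    replace (d + (INR M + 1) * h) with (d + INR M * h + h) by ring.
    rewrite Rmult_plus_distr_l. lra. }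
eapply Rle_trans; [exact H|].
pose proof (Rpower_pos (d + INR M * h) (- p)).
assert (0 < / p) by now apply Rinv_0_lt_compat. nra.
Qed.

Lemma sum_n_le (f g : nat -> R) (m : nat) :
  (forall j, (j <= m)%nat -> f j <= g j) -> sum_n f m <= sum_n g m.
Proof.
intros H. induction m as [|m IH].
- rewrite !sum_O. apply H; lia.
- rewrite !sum_Sn. apply Rplus_le_compat; [|apply H; lia].
  apply IH. intros j Hj. apply H; lia.
Qed.

Lemma sum_n_rev (f : nat -> R) (m : nat) : sum_n (fun j => f (m - j)%nat) m = sum_n f m.
Proof.
induction m as [|m IH]; [now rewrite !sum_O|].
rewrite (sum_Sn f), <- IH. unfold sum_n at 1.
rewrite sum_Sn_m, <- sum_n_m_S by lia. apply Rplus_comm.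
Qed.

(** A term at the minimum of two arguments is at most the sum of the terms at each, which splits the
    sum into two one-sided Riemann sums. *)
Lemma arc_sum_le (p d : R) (m : nat) : 0 < p -> 0 < d -> 1 <= d * INR (S m) ->
  / INR (S m) * sum_n (fun j => Rpower (d + arc (S m) j) (- (p + 1))) m
    <= 2 * ((1 + / p) * Rpower d (- p)).
Proof.
intros Hp Hd HdN.
assert (HN : 0 < INR (S m)) by (apply lt_0_INR; lia).
set (g := fun j => Rpower (d + INR j / INR (S m)) (- (p + 1))).
assert (Hpos : forall j, 0 <= INR j / INR (S m)).
{ intros j. apply Rdiv_le_0_compat; [apply pos_INR|assumption]. }
apply Rle_trans with (/ INR (S m) * (sum_n g m + sum_n g m)).
- apply Rmult_le_compat_l; [left; now apply Rinv_0_lt_compat|].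
  rewrite <- (sum_n_rev g m) at 2. rewrite <- (sum_n_plus (G := R_AbelianMonoid)).
  apply sum_n_le. intros j Hj. change plus with Rplus.
  (* Reversing the sum over [0..m] produces the index [m - j] rather than [S m - j]; the shift is
     allowed because [g] decreases. *)
  assert (Hg : g (S m - j)%nat <= g (m - j)%nat).
  { apply Rpower_opp_antitone; [|lra]. split; [pose proof (Hpos (m - j)%nat); lra|].
    apply Rplus_le_compat_l, Rmult_le_compat_r; [left; now apply Rinv_0_lt_compat|].
    apply le_INR; lia. }
  assert (0 < g j) by apply Rpower_pos.
  assert (0 < g (S m - j)%nat) by apply Rpower_pos.
  unfold arc. apply Rmin_case; fold (g j) (g (S m - j)%nat); lra.
- assert (H := Riemann_sum_Rpower_le p d (S m) m Hp Hd ltac:(lia) HdN).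
  fold g in H. lra.
Qed.

(* Both bounds on [B] are combined as a power of [max u d >= (d + a) / 2]. *)
Lemma weighted_min_le (u d a K B alpha : R) (k : nat) :
  0 < u -> 0 < d -> 0 <= a <= u -> 0 <= K -> INR k <= alpha ->
  B <= K * Rpower u (- alpha) -> B <= K * Rpower d (- alpha) ->
  u ^ k * B <= K * Rpower 2 (alpha - INR k) * Rpower (d + a) (- (alpha - INR k)).
Proof.
intros Hu Hd Ha HK Hk Bu Bd.
assert (H : exists w, 0 < w /\ u <= w /\ d <= w /\ B <= K * Rpower w (- alpha)).
{ destruct (Rle_dec u d); [exists d|exists u]; repeat split; lra. }
destruct H as [w [Hw [Huw [Hdw HB]]]].
set (s := alpha - INR k) in *.
assert (E1 : w ^ k * Rpower w (- alpha) = Rpower w (- s)).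
{ rewrite <- Rpower_pow, <- Rpower_plus by assumption. f_equal. unfold s. ring. }
assert (E2 : Rpower w (- s) = Rpower 2 s * Rpower (2 * w) (- s)).
{ rewrite <- (Rpower_mult_distr 2 w), <- Rmult_assoc, <- Rpower_plus by lra.
  rewrite Rplus_opp_r, Rpower_O by lra. ring. }
assert (H3 : Rpower (2 * w) (- s) <= Rpower (d + a) (- s)).
{ apply Rpower_opp_antitone; [lra|unfold s; lra]. }
assert (Hwk : 0 <= u ^ k <= w ^ k) by (split; [apply pow_le|apply pow_incr]; lra).
pose proof (Rpower_pos w (- alpha)). pose proof (Rpower_pos 2 s).
apply Rle_trans with (u ^ k * (K * Rpower w (- alpha))).
- apply Rmult_le_compat_l; lra.
- apply Rle_trans with (w ^ k * (K * Rpower w (- alpha))).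
  + apply Rmult_le_compat_r; [nra|lra].
  + replace (w ^ k * (K * Rpower w (- alpha))) with (K * (w ^ k * Rpower w (- alpha))) by ring.
    rewrite E1, E2, Rmult_assoc. apply Rmult_le_compat_l; [assumption|].
    apply Rmult_le_compat_l; lra.
Qed.

(** * The estimate *)

(** At each node [weighted_min_le] merges the two resolvent bounds into a multiple of
    [(d + arc)^(-(p+1))] with [p = alpha - k - 1 > 0], and [arc_sum_le] bounds the mean of these
    powers. The factor [r^(S n)] is the modulus of [l^(S n)]. *)
Lemma norm_contour_le {X : NormedModule C_AbsRing} (T : X -> X) (alpha r d K : R)
    (m n k : nat) (x : X) :
  spectrum_in_closed_disk T -> 1 < r -> 0 < d -> 0 <= K -> INR k < alpha - 1 ->
  1 <= d * INR (S m) ->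
  (forall l, Cmod l = r -> opnorm (resolvent l T) <= K * Rpower (Cmod (l - 1)%C) (- alpha)) ->
  (forall l, Cmod l = r -> opnorm (resolvent l T) <= K * Rpower d (- alpha)) ->
  norm (contour T r m n k x)
    <= r ^ S n * (K * Rpower 2 (alpha - INR k)
         * (2 * ((1 + / (alpha - INR k - 1)) * Rpower d (- (alpha - INR k - 1))))) * norm x.
Proof.
intros Hsp Hr Hd HK Hk Hdm HRitt HKreiss.
set (p := alpha - INR k - 1). assert (Hp : 0 < p) by (unfold p; lra).
set (C1 := r ^ S n * (K * Rpower 2 (alpha - INR k)) * norm x).
assert (HC1 : 0 <= C1).
{ pose proof (pow_le r (S n) ltac:(lra)). pose proof (Rpower_pos 2 (alpha - INR k)).
  apply Rmult_le_pos; [apply Rmult_le_pos; [assumption|nra]|apply norm_ge_0]. }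
eapply Rle_trans.
{ apply norm_mean_le
    with (B := fun j => C1 * Rpower (d + arc (S m) j) (- (p + 1))).
  intros j Hj.
  set (l := node r (S m) j).
  assert (Hl : Cmod l = r) by (unfold l, node; apply Cmod_polar; lra).
  assert (Hu : 0 < Cmod (l - 1)%C).
  { apply Cmod_gt_0. intros E.
    assert (El : l = RtoC 1) by (replace l with (l - 1 + 1)%C by ring; rewrite E; ring).
    rewrite El, Cmod_1 in Hl. lra. }
  assert (Harc : 0 <= arc (S m) j <= Cmod (l - 1)%C).
  { split; [|apply arc_le_Cmod; lia || lra].
    assert (0 < INR (S m)) by (apply lt_0_INR; lia).
    unfold arc. apply Rmin_case; apply Rdiv_le_0_compat; try assumption; apply pos_INR. }
  assert (HB := weighted_min_le _ d _ K _ alpha k Hu Hd Harc HK ltac:(lra)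
                 (HRitt l Hl) (HKreiss l Hl)).
  replace (p + 1) with (alpha - INR k) by (unfold p; ring).
  eapply Rle_trans; [apply norm_scal_C|].
  rewrite Cmod_mult, !Cmod_pow, Hl, <- (Cmod_opp (1 - l)).
  replace (- (1 - l))%C with (l - 1)%C by ring.
  apply Rle_trans with (r ^ S n * Cmod (l - 1)%C ^ k * (opnorm (resolvent l T) * norm x)).
  - apply Rmult_le_compat_l.
    + apply Rmult_le_pos; apply pow_le; lra.
    + apply norm_le_opnorm, resolvent_is_inverse; [assumption|lra].
  - unfold C1.
    apply Rle_trans with (r ^ S n * norm x * (Cmod (l - 1)%C ^ k * opnorm (resolvent l T)));
      [right; ring|].
    eapply Rle_trans; [apply Rmult_le_compat_l; [|exact HB]|right; ring].
    apply Rmult_le_pos; [apply pow_le; lra|apply norm_ge_0]. }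
set (f := fun j => Rpower (d + arc (S m) j) (- (p + 1))).
change (sum_n _ m) with (sum_n (fun j => C1 * f j) m).
replace (sum_n (fun j => C1 * f j) m) with (C1 * sum_n f m)
  by (symmetry; exact (sum_n_mult_l (K := R_Ring) C1 f m)).
assert (H := arc_sum_le p d m Hp Hd Hdm). fold f in H.
apply Rmult_le_compat_l with (r := C1) in H; [|assumption].
eapply Rle_trans; [|eapply Rle_trans; [exact H|]]; right; unfold C1; ring.
Qed.

(** The first [n] factors have product at most [exp (1/2) <= 3], and the last factor is at most
    [2]. *)
Lemma pow_1_plus_half_inv_le (n : nat) : (1 <= n)%nat -> (1 + / (2 * INR n)) ^ S n <= 6.
Proof.
intros Hn. apply le_INR in Hn. simpl in Hn.
set (h := / (2 * INR n)).
assert (Hh : 0 < h) by (apply Rinv_0_lt_compat; lra).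
assert (Hnh : INR n * h = 1 / 2) by (unfold h; field; lra).
assert (Hp : (1 + h) ^ n <= 3).
{ apply Rle_trans with (exp h ^ n).
  - apply pow_incr. pose proof (exp_ineq1_le h). lra.
  - rewrite <- Rpower_pow by apply exp_pos. unfold Rpower. rewrite ln_exp, Hnh.
    apply Rle_trans with (exp 1); [|exact exp_le_3].
    left. apply exp_increasing. lra. }
simpl. assert (h <= 1) by nra.
pose proof (pow_le (1 + h) n ltac:(lra)). nra.
Qed.

(** With [S] the contour mean for [a = b = 0] and [G = T^n (I-T)^k], write
    [G x = G S x - G (S x - x)]. The first term is the contour mean with exponents [n], [k]; the
    second is small for large [m], since [G] is a fixed bounded operator and [S] tends to [I]. *)
Lemma norm_le_of_contour_le {X : NormedModule C_AbsRing} (T : X -> X) (r B : R) (n k : nat) :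
  is_linear T -> spectrum_in_closed_disk T -> 1 < r -> 0 < B ->
  (exists M, 0 < M /\ forall l, Cmod l = r -> opnorm (resolvent l T) <= M) ->
  (exists m0, forall m, (m0 <= m)%nat -> forall x, norm (contour T r m n k x) <= B * norm x) ->
  forall x, norm (opcomp (oppow T n) (oppow (scalar_minus 1 T) k) x) <= 2 * B * norm x.
Proof.
intros HT Hsp Hr HB [M [HM HR]] [m0 Hm0] x.
set (G := opcomp (oppow T n) (oppow (scalar_minus 1 T) k)).
assert (HG : is_linear G).
{ apply (is_linear_comp (oppow (scalar_minus 1 T) k) (oppow T n));
    apply is_linear_oppow; [apply is_linear_scalar_minus|]; assumption. }
destruct (linear_norm G HG) as [g [Hg HGg]].
(* The radius [(1 + r) / 2] lies strictly between [1] and [r], so [spectral_radius_le_1] makes it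
   dominated. The accuracy [B / g] compensates the norm bound [g] of [G]. *)
destruct (contour_00_converges T r ((1 + r) / 2) M (B / g)) as [m1 Hm1]; try assumption; try lra.
{ now apply Rdiv_lt_0_compat. }
{ apply spectral_radius_le_1; try assumption; lra. }
{ intros N j Hj y.
  assert (Hl : Cmod (node r N j) = r) by (apply Cmod_polar; lra).
  eapply Rle_trans; [apply norm_le_opnorm, resolvent_is_inverse; [assumption|lra]|].
  apply Rmult_le_compat_r; [apply norm_ge_0|]. now apply HR. }
set (m := (m0 + m1 + n + k)%nat).
set (y := contour T r m 0 0 x).
assert (H1 : norm (G y) <= B * norm x).
{ unfold G, y. rewrite <- contour_poly by (assumption || lia). apply Hm0. lia. }
assert (H2 : norm (G (minus y x)) <= B * norm x).
{ eapply Rle_trans; [apply HGg|].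
  apply Rle_trans with (g * (B / g * norm x)); [|right; field; lra].
  apply Rmult_le_compat_l; [lra|]. apply Hm1. lia. }
assert (E : G x = minus (G y) (G (minus y x))).
{ symmetry. apply minus_eq. rewrite <- (linear_plus G HG). f_equal.
  symmetry. apply minus_add. }
rewrite E. unfold minus at 1.
eapply Rle_trans; [apply (norm_triangle (V := X))|]. rewrite norm_opp. lra.
Qed.

Theorem proposition5p1
  (alpha beta : R) (Halpha : 1 < alpha) (Hbeta : 1 < beta < alpha)
  (X : CompleteNormedModule C_AbsRing)
  (T : X -> X) (HT : is_linear T)
  (HRitt : Ritt alpha T) (HKreiss : Kreiss_bounded beta T)
  (k : nat) (Hk : (1 <= k)%nat) (Hkalpha : INR k < alpha - 1) :
  is_bigO
    (fun n => opnorm (opcomp (oppow T n) (oppow (scalar_minus 1 T) k)))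
    (fun n => Rpower (INR n) (beta * ((alpha - INR k - 1) / alpha))).
Proof.
destruct HRitt as [Hsp [K1 [HK1 HR1]]]. destruct HKreiss as [_ [K2 [HK2 HR2]]].
(* On the circle [|l| - 1 = 1 / (2n)], so the Kreiss bound reads [K2 (2n)^beta = K2' n^beta]. *)
set (K2' := K2 * Rpower 2 beta).
assert (HK2' : 0 < K2') by (apply Rmult_lt_0_compat; [assumption|apply Rpower_pos]).
set (K := K1 + K2').
set (p := alpha - INR k - 1). assert (Hp : 0 < p) by (unfold p; lra).
(* This is the constant of [norm_contour_le] without [d^(-p)], with [r^(S n)] replaced by its bound
   [6]. *)
set (B := 6 * (K * Rpower 2 (alpha - INR k) * (2 * (1 + / p)))).
assert (HB : 0 < B).
{ pose proof (Rpower_pos 2 (alpha - INR k)). pose proof (Rinv_0_lt_compat p Hp).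
  unfold B. repeat apply Rmult_lt_0_compat; unfold K; lra. }
exists (2 * B). split; [lra|]. intros n Hn.
assert (Hn1 : 1 <= INR n) by (apply le_INR in Hn; exact Hn).
set (r := 1 + / (2 * INR n)).
assert (Hh : 0 < / (2 * INR n) < 1).
{ split; [apply Rinv_0_lt_compat; lra|]. rewrite <- Rinv_1. apply Rinv_lt_contravar; lra. }
(* The two resolvent bounds balance at [|l - 1| = d]. *)
set (d := Rpower (INR n) (- (beta / alpha))).
assert (Hd : 0 < d) by apply Rpower_pos.
assert (Hda : Rpower d (- alpha) = Rpower (INR n) beta).
{ unfold d. rewrite Rpower_mult. f_equal. field. lra. }
assert (Hdp : Rpower d (- p) = Rpower (INR n) (beta * (p / alpha))).
{ unfold d. rewrite Rpower_mult. f_equal. field. lra. }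
assert (HRit : forall l, Cmod l = r ->
  opnorm (resolvent l T) <= K * Rpower (Cmod (l - 1)%C) (- alpha)).
{ intros l Hl. eapply Rle_trans; [apply HR1; rewrite Hl; unfold r; lra|].
  rewrite Rpower_Ropp. apply Rmult_le_compat_r; [|unfold K; lra].
  left. apply Rinv_0_lt_compat, Rpower_pos. }
assert (HKre : forall l, Cmod l = r -> opnorm (resolvent l T) <= K * Rpower d (- alpha)).
{ intros l Hl. eapply Rle_trans; [apply HR2; rewrite Hl; unfold r; lra|].
  rewrite Hl, Hda. unfold r. replace (1 + / (2 * INR n) - 1) with (/ (2 * INR n)) by ring.
  assert (E : / Rpower (/ (2 * INR n)) beta = Rpower 2 beta * Rpower (INR n) beta).
  { rewrite Rpower_mult_distr by lra. unfold Rpower.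
    rewrite ln_Rinv by lra. rewrite Ropp_mult_distr_r_reverse, exp_Ropp. apply Rinv_inv. }
  unfold Rdiv. rewrite E, <- Rmult_assoc. fold K2'.
  apply Rmult_le_compat_r; [left; apply Rpower_pos|unfold K; lra]. }
rewrite <- Hdp, Rmult_assoc.
assert (HBd : 0 < B * Rpower d (- p)) by (apply Rmult_lt_0_compat; [assumption|apply Rpower_pos]).
apply opnorm_le.
- apply (is_linear_comp (oppow (scalar_minus 1 T) k) (oppow T n));
    apply is_linear_oppow; [apply is_linear_scalar_minus|]; assumption.
- lra.
- apply norm_le_of_contour_le with (r := r); try assumption.
  + unfold r; lra.
  + exists (K * Rpower d (- alpha)). split; [|exact HKre].
    apply Rmult_lt_0_compat; [unfold K; lra|apply Rpower_pos].
  (* Taking [m] beyond [1 / d] makes the mesh [1 / S m] at most [d], as the Riemann sum estimate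
     requires. *)
  + destruct (INR_unbounded (/ d)) as [m0 Hm0]. exists m0. intros m Hm x.
    eapply Rle_trans.
    * apply norm_contour_le with (d := d) (K := K) (alpha := alpha); try assumption.
      -- unfold r; lra.
      -- unfold K; lra.
      -- apply Rmult_le_reg_l with (/ d); [now apply Rinv_0_lt_compat|].
         rewrite <- Rmult_assoc, Rinv_l, Rmult_1_r, Rmult_1_l by lra.
         apply Rle_trans with (INR m0); [lra|]. apply le_INR; lia.
    * apply Rmult_le_compat_r; [apply norm_ge_0|]. fold p.
      replace (B * Rpower d (- p)) with
        (6 * (K * Rpower 2 (alpha - INR k) * (2 * ((1 + / p) * Rpower d (- p)))))
        by (unfold B; ring).
      apply Rmult_le_compat_r; [|now apply pow_1_plus_half_inv_le].
      pose proof (Rpower_pos 2 (alpha - INR k)). pose proof (Rpower_pos d (- p)).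
      pose proof (Rinv_0_lt_compat p Hp).
      repeat apply Rmult_le_pos; unfold K; lra.
Qed.
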